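(* Let $Z\sim\mathcal{N}(0,1)$ and let $Y=X+Z$ with $X$ independent of $Z$. Fix $p\in(2,\infty)$ and $a\in(0,1)$. Then for every $\rho\in[-1,1]$ and every $\theta\in\mathbb{R}$ there exists $\omega\neq 0$ such that, if $X$ has density $$f_X(x)\propto e^{-\frac{1-a}{a}\frac{x^2}{2}}\left(1+\rho\cos\!\left(\frac{\omega x}{\sqrt a}+\theta\right)\right),$$ then the estimator $y\mapsto ay$ minimizes $\mathbb{E}\big[|X-g(Y)|^p\big]$ over measurable $g$. Moreover, for even $p$, every real zero $\omega$ of the probabilists' Hermite polynomial $He_{p-1}$ has this property.
   Context: The probabilists' Hermite polynomials are defined by $He_k(x)=(-1)^k e^{x^2/2}\frac{\mathrm{d}^k}{\mathrm{d}x^k}e^{-x^2/2}$. *)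

(* Defs.v *)
From HB Require Import structures.
From mathcomp Require Import all_boot all_order all_algebra.
From mathcomp Require Import all_classical all_reals all_analysis.
Set Implicit Arguments. Unset Strict Implicit. Unset Printing Implicit Defensive.
Import Order.TTheory GRing.Theory Num.Theory.
Import numFieldNormedType.Exports.
Local Open Scope classical_set_scope.
Local Open Scope ring_scope.

(* Probabilists' Hermite polynomial, Rodrigues form:
   He_k(x) = (-1)^k e^{x^2/2} d^k/dx^k e^{-x^2/2}. *)
Definition hermite_He {R : realType} (k : nat) (x : R) : R :=
  (-1) ^+ k * expR (x ^+ 2 / 2) *
  (derive1n k (fun t : R => expR (- (t ^+ 2 / 2)))) x.

Definition fX_unnorm {R : realType} (a rho theta omega : R) (x : R) : R :=
  expR (- ((1 - a) / a * (x ^+ 2 / 2))) *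
  (1 + rho * cos (omega * x / Num.sqrt a + theta)).

Definition indep_rv {d} {T : measurableType d} {R : realType}
  (P : probability T R) (X Z : T -> R) : Prop :=
  forall A B : set R, measurable A -> measurable B ->
    P (X @^-1` A `&` Z @^-1` B) = (P (X @^-1` A) * P (Z @^-1` B))%E.

Definition linear_estimator_optimal {R : realType}
  (p a rho theta omega : R) : Prop :=
  forall (d : measure_display) (T : measurableType d) (P : probability T R)
         (X Z : T -> R),
    measurable_fun setT X -> measurable_fun setT Z ->
    indep_rv P X Z ->
    (forall A : set R, measurable A -> P (Z @^-1` A) = normal_prob 0 1 A) ->
    (exists c : R, 0 < c /\ forall A : set R, measurable A ->
        P (X @^-1` A) =
        (c%:E * \int[lebesgue_measure]_(x in A) (fX_unnorm a rho theta omega x)%:E)%E) ->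
    forall g : R -> R, measurable_fun setT g ->
      ('E_P[fun w => ((`| X w - a * (X w + Z w) |) `^ p)%R]
       <= 'E_P[fun w => ((`| X w - g (X w + Z w) |) `^ p)%R])%E.

(* Main.v *)
(* Substituting x = a y + sqrt a u, the loss given Y = y becomes, up to a factor,
   the integral of |u - b|^p against exp (- u^2 / 2) (1 + rho cos (omega u + psi)),
   with b = 0 for the linear estimator. Since |u - b|^p lies above its tangent
   |u|^p - p b k(u), k(u) = u |u|^(p - 2), the value b = 0 is optimal as soon as k
   integrates to 0 against this weight. As k is odd, this only requires
   S(omega) = 0, where S(w) is the integral of k(u) sin (w u) exp (- u^2 / 2).
   Invariance of the integral under dilations of u gives S'' + w S' + p S = 0 with
   S(0) = 0, and a Sturm comparison with w exp (- w^2 / 2), the solution for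
   p = 2, shows that S has a positive zero when p > 2. For even p, S is up to
   sign the (p - 1)-st derivative of the Fourier transform of the Gaussian,
   which the same equation for k = 1 identifies as a multiple of
   exp (- w^2 / 2); hence S vanishes at the zeros of He_(p - 1). *)
Require Import Defs.
From HB Require Import structures.
From mathcomp Require Import all_boot all_order all_algebra.
From mathcomp Require Import all_classical all_reals all_analysis.
From mathcomp Require Import ring lra.
From mathcomp Require Import measurable_realfun.
Import Order.TTheory GRing.Theory Num.Theory.
Import numFieldNormedType.Exports.
Local Open Scope classical_set_scope.
Local Open Scope ring_scope.

(** * Affine substitution in Lebesgue integrals over the real line *)

Section affine_change_of_variables.
Local Open Scope ereal_scope.
Context {R : realType}.
Local Notation mu := (@lebesgue_measure R).
Variables (a b : R).
Hypothesis a0 : a != 0%R.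

Let aff : measurableTypeR R -> measurableTypeR R := fun x : R => (a * x + b)%R.

Let measurable_aff : measurable_fun [set: measurableTypeR R] aff.
Proof. by apply: measurable_funD => //; apply: measurable_funM. Qed.

Let a_gt0 : (0 < `|a|)%R. Proof. by rewrite normr_gt0. Qed.
Let k : {nonneg R} := NngNum (ltW a_gt0).

(* The measure instance of [pushforward] takes the measurability proof as an
   argument, so it has to be named explicitly. *)
Let aff_mu : {measure set (measurableTypeR R) -> \bar R} :=
  measure_function_pushforward__canonical__measure_function_Measure
    mu measurable_aff.

(** Lebesgue measure is determined by its values on half-open intervals, whose preimages under an
    affine map are again intervals. *)
Let lebesgue_measure_affine (A : set R) : measurable A ->
  mscale k aff_mu A = mu A.
Proof.
move=> mA.
apply/esym/lebesgue_measure_unique => //= _ [[x y]] _ <-.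
rewrite /mscale /= /aff_mu /= /pushforward.
have [a_pos|a_neg] := ltP 0%R a.
  rewrite (_ : aff @^-1` _ = `](x - b) / a, (y - b) / a]%classic)%R; last first.
    apply/seteqP; split => z /=; rewrite !in_itv/= /aff;
    by rewrite ltr_pdivrMr// ler_pdivlMr// ltrBlDr lerBrDr (mulrC z).
  rewrite !lebesgue_measure_itv/= !lte_fin ltr_pM2r ?invr_gt0// ltrD2r.
  case: ifPn => _; rewrite ?mule0// -!EFinB -EFinM gtr0_norm//; congr EFin.
  by field.
(* A negative slope exchanges the endpoints, so the preimage is closed on the left and open on the
   right; its length is unaffected. *)
have {}a_neg : (a < 0)%R by rewrite lt_neqAle a0.
rewrite (_ : aff @^-1` _ = `[(y - b) / a, (x - b) / a[%classic)%R; last first.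
  apply/seteqP; split => z /=; rewrite !in_itv/= /aff;
  by rewrite ltr_ndivlMr// ler_ndivrMr// ltrBlDr lerBrDr (mulrC z) andbC.
rewrite !lebesgue_measure_itv/= !lte_fin ltr_nM2r ?invr_lt0// ltrD2r.
case: ifPn => _; rewrite ?mule0// -!EFinB -EFinM ltr0_norm//; congr EFin.
by field.
Qed.

Lemma ge0_integral_affine (f : R -> \bar R) :
  measurable_fun [set: R] f -> (forall x, 0 <= f x) ->
  `|a|%:E * \int[mu]_x f (a * x + b)%R = \int[mu]_x f x.
Proof.
move=> mf f0.
transitivity (\int[mscale k aff_mu]_x f x).
  by rewrite ge0_integral_mscale// ge0_integral_pushforward.
by apply: eq_measure_integral => A mA _; exact: lebesgue_measure_affine.
Qed.

Lemma integrable_affine (f : R -> R) : mu.-integrable setT (EFin \o f) ->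
  mu.-integrable setT (fun x => (f (a * x + b)%R)%:E).
Proof.
move=> /integrableP[mf foo]; apply/integrableP; split.
  exact: (measurableT_comp mf measurable_aff).
move: foo; rewrite -(ge0_integral_affine (fun x => `|(f x)%:E|)) => [|//|//].
  move: (\int[mu]_x _) => [r _||//]; first by rewrite ltry.
  by rewrite gt0_muley ?lte_fin.
exact: measurableT_comp.
Qed.

Lemma Rintegral_affine (f : R -> R) : mu.-integrable setT (EFin \o f) ->
  (`|a| * \int[mu]_x f (a * x + b) = \int[mu]_x f x)%R.
Proof.
move=> intf.
have intfa : mu.-integrable setT ((EFin \o f) \o aff).
  exact: integrable_affine.
rewrite /Rintegral -[X in (X * _)%R]/(fine `|a|%:E) -fineM//; last first.
  exact: integrable_fin_num intfa.
have mf : measurable_fun setT (EFin \o f) by exact: measurable_int intf.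
congr fine.
rewrite -[X in _ * integral _ _ X]/((EFin \o f) \o aff).
rewrite integralE [in RHS]integralE funepos_comp funeneg_comp muleBr//=.
  rewrite -(ge0_integral_affine (EFin \o f)^\+)//.
    rewrite -(ge0_integral_affine (EFin \o f)^\-)//.
    exact: measurable_funeneg.
  exact: measurable_funepos.
have := integrable_add_def measurableT intfa.
by rewrite (funepos_comp (EFin \o f) aff) (funeneg_comp (EFin \o f) aff).
Qed.

End affine_change_of_variables.

(** * Integration against a measure given by a density *)

Section density.
Local Open Scope ereal_scope.
Context d (T : measurableType d) (R : realType).
Variables (mu nu : {measure set T -> \bar R}) (h : T -> R).
Hypotheses (mh : measurable_fun [set: T] h) (h0 : forall x, (0 <= h x)%R).
Hypothesis nuE : forall A, measurable A -> nu A = \int[mu]_(x in A) (h x)%:E.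

Import HBNNSimple.

(** A simple function is a finite combination of indicators of its level sets, and on those [nuE] is
    the claim. *)
Let ge0_integral_density_nnsfun (f : {nnsfun T >-> R}) :
  \int[nu]_x (f x)%:E = \int[mu]_x ((f x)%:E * (h x)%:E).
Proof.
have mhE : measurable_fun [set: T] (EFin \o h) by exact/measurable_EFinP.
transitivity (\sum_(r \in range f) r%:E * nu (f @^-1` [set r])).
  by rewrite integralT_nnsfun sintegralE.
transitivity (\int[mu]_x
    (\sum_(r \in range f) (r * \1_(f @^-1` [set r]) x)%:E * (h x)%:E)).
  rewrite ge0_integral_fsum//; last 2 first.
  - move=> r; apply: emeasurable_funM => //; apply/measurable_EFinP.
    exact: measurable_funM.
  - by move=> r x _; rewrite mule_ge0 ?lee_fin// -lee_fin EFinM nnfun_muleindic_ge0.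
  apply: eq_fsbigr => r; rewrite inE => -[t _ <-].
  rewrite nuE//.
  under [RHS]eq_integral do rewrite EFinM -muleA.
  rewrite ge0_integralZl//; first last.
  - by rewrite lee_fin.
  - by move=> x _; rewrite mule_ge0 ?lee_fin.
  - by apply: emeasurable_funM => //; apply/measurable_EFinP.
  congr *%E; rewrite integral_mkcond; apply: eq_integral => x _.
  by rewrite epatch_indic muleC.
apply: eq_integral => x _; rewrite -ge0_mule_fsuml => [|r]; last first.
  exact: nnfun_muleindic_ge0.
by rewrite fsumEFin // -fimfunE.
Qed.

(** Monotone convergence, applied on both sides to an increasing approximation by simple
    functions. *)
Lemma ge0_integral_density (f : T -> \bar R) :
  measurable_fun [set: T] f -> (forall x, 0 <= f x) ->
  \int[nu]_x f x = \int[mu]_x (f x * (h x)%:E).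
Proof.
move=> mf f0; pose f_ := nnsfun_approx measurableT mf.
transitivity (limn (fun n => \int[nu]_x (f_ n x)%:E)).
  rewrite -monotone_convergence//.
  - by apply: eq_integral => x _; apply/esym/cvg_lim => //;
      exact: cvg_nnsfun_approx.
  - by move=> n; exact/measurable_EFinP.
  - by move=> n x _; rewrite lee_fin.
  - by move=> x _ m n mn; rewrite lee_fin; exact/lefP/nd_nnsfun_approx.
under eq_fun do rewrite ge0_integral_density_nnsfun.
rewrite -monotone_convergence//.
- apply: eq_integral => x _; apply/cvg_lim => //; apply: cvgeZr => //.
  exact: cvg_nnsfun_approx.
- by move=> n; apply: emeasurable_funM; exact/measurable_EFinP.
- by move=> n x _; rewrite mule_ge0 ?lee_fin.
- move=> x _ m n mn; rewrite lee_wpmul2r ?lee_fin//.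
  exact/lefP/nd_nnsfun_approx.
Qed.

End density.

(** * Differentiation rules for real functions *)

Section pointwise_derivatives.
Context {R : realType}.
Implicit Types (f g : R -> R) (t a b : R).

Lemma is_derive1_opp f t a : is_derive t (1 : R) f a ->
  is_derive t (1 : R) (fun x => - f x) (- a).
Proof. by move=> df; exact: (is_deriveN df). Qed.

Lemma is_derive1_mul f g t a b : is_derive t (1 : R) f a ->
  is_derive t (1 : R) g b ->
  is_derive t (1 : R) (fun x => f x * g x) (a * g t + f t * b).
Proof.
move=> df dg; apply: (is_derive_eq (is_deriveM df dg)).
by rewrite /GRing.scale /= addrC (mulrC a).
Qed.

Lemma is_derive1_expR f t a : is_derive t (1 : R) f a ->
  is_derive t (1 : R) (fun x => expR (f x)) (expR (f t) * a).
Proof.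
move=> df; have de := is_derive_expR (f t).
by exact: (is_derive1_comp (f := expR)).
Qed.

Lemma is_derive1_cos f t a : is_derive t (1 : R) f a ->
  is_derive t (1 : R) (fun x => cos (f x)) (- sin (f t) * a).
Proof.
move=> df; have de := is_derive_cos (f t).
by exact: (is_derive1_comp (f := cos)).
Qed.

Lemma is_derive1_cst (c : R) t : is_derive t (1 : R) (fun=> c) 0.
Proof. exact: is_derive_cst. Qed.

End pointwise_derivatives.

(** * Positive zeros of solutions of [f'' + t f' + p f = 0] *)

Section oscillation.
Context {R : realType}.
Implicit Types f : R -> R.

Lemma mean_value f f' (a b : R) : a < b ->
  (forall t : R, a <= t <= b -> is_derive t (1:R) f (f' t)) ->
  exists2 c, a < c < b & f b - f a = f' c * (b - a).
Proof.
move=> ab df.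
have cf : {within `[a, b], continuous f}.
  apply: derivable_within_continuous => t; rewrite in_itv/= => /df.
  by case.
have dfo t : t \in `]a, b[ -> is_derive t (1:R) f (f' t).
  by rewrite in_itv/= => /andP[a_t tb]; apply: df; rewrite !ltW.
by have [c] := MVT ab dfo cf; rewrite in_itv/=; exists c.
Qed.

(* Sturm comparison with [t * exp (- t ^ 2 / 2)], which solves the equation for
   [p = 2] without vanishing: [W] is the Wronskian up to a factor [exp (t ^ 2 / 2)],
   and the quotient [Q] of the two solutions has derivative
   [exp (t ^ 2 / 2) * W / t ^ 2]. *)
Let no_positive_solution (p : R) f f' f'' :
  2 < p ->
  (forall t : R, is_derive t (1:R) f (f' t)) -> (forall t : R, is_derive t (1:R) f' (f'' t)) ->
  (forall t, f'' t + t * f' t + p * f t = 0) -> f 0 = 0 ->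
  ~ (forall t : R, 0 < t -> 0 < f t).
Proof.
move=> p2 df df' ode f0 fpos.
pose W t := t * f' t - (1 - t ^+ 2) * f t.
have dW (t : R) : is_derive t (1:R) W ((2 - p) * (t * f t)).
  have H1 := df t; have H2 := df' t.
  rewrite /W; apply: is_derive_eq; rewrite /GRing.scale /=.
  have -> : f'' t = - (t * f' t) - p * f t by have := ode t; lra.
  ring.
have W0 : W 0 = 0 by rewrite /W f0; ring.
(* For [p > 2] and [f > 0] the derivative of [W] is negative on the positive half-line, so [W] drops
   below [W 0 = 0] and stays there. *)
have W1 : W 1 < 0.
  have [c /andP[c0 _]] := mean_value _ _ _ _ ltr01 (fun t _ => dW t).
  rewrite W0 !subr0 mulr1 => ->.
  by rewrite nmulr_rlt0 ?subr_lt0// mulr_gt0// fpos.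
have W_ge1 (t : R) : 1 <= t -> W t <= W 1.
  rewrite le_eqVlt => /predU1P[<-//|t1].
  have [c /andP[c1 _]] := mean_value _ _ _ _ t1 (fun t _ => dW t).
  have c0 : 0 < c by exact: lt_trans c1.
  rewrite -subr_le0 => ->; rewrite pmulr_lle0 ?subr_gt0//.
  by rewrite nmulr_rle0 ?subr_lt0// ltW// mulr_gt0// fpos.
pose e (t : R) := expR (t ^+ 2 / 2).
pose Q t := f t * e t / t.
have dQ (t : R) : 1 <= t -> is_derive t (1 : R) Q (e t * W t / t ^+ 2).
  move=> t1; have t0 : t != 0 by rewrite gt_eqF// (lt_le_trans _ t1).
  have H1 := df t.
  have de : is_derive t (1 : R) e (e t * t).
    rewrite /e; have -> : e t * t = expR (t ^+ 2 / 2) * (t / 2 + t / 2).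
      by rewrite /e; congr (_ * _); lra.
    apply: is_derive1_expR; apply: is_derive_eq; rewrite /GRing.scale /=.
    ring.
  have dV : is_derive t (1 : R) (fun x => x^-1) (- t ^- 2).
    apply: is_derive_eq; [exact: is_deriveV|]; rewrite /GRing.scale /=.
    by rewrite mulr1.
  rewrite /Q; apply: is_derive_eq; rewrite /W /GRing.scale /=.
  by field.
(* Since [e c >= c ^+ 2 / 2] and [W c <= W 1 < 0], the slope of [Q] beyond [1] is at most
   [W 1 / 2]. *)
have Q_le (t : R) : 1 < t -> Q t <= Q 1 + W 1 / 2 * (t - 1).
  move=> t1.
  have [c /andP[c1 _] QE] := mean_value _ _ _ _ t1
    (fun x (xI : 1 <= x <= t) => dQ x (proj1 (andP xI))).
  rewrite -lerBlDl QE ler_wpM2r ?subr_ge0 ?(ltW t1)//.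
  have c0 : 0 < c by exact: lt_trans c1.
  have ec : c ^+ 2 / 2 <= e c.
    by apply: le_trans (expR_ge1Dx _); rewrite lerDr.
  rewrite ler_pdivrMr ?exprn_gt0//.
  have := W_ge1 c (ltW c1); have : 0 <= c ^+ 2 by exact: sqr_ge0.
  move: ec W1; nra.
have Q1 : 0 < Q 1 by rewrite /Q divr_gt0// mulr_gt0 ?expR_gt0// fpos.
(* The point where the linear upper bound for [Q] reaches [0], although [Q] is positive there. *)
pose t := 1 - 2 * Q 1 / W 1.
have t1 : 1 < t by rewrite ltrDl oppr_gt0 nmulr_llt0 ?invr_lt0// mulr_gt0.
have Qt : 0 < Q t.
  have t0 : 0 < t by exact: lt_trans t1.
  by rewrite /Q divr_gt0// mulr_gt0 ?expR_gt0// fpos.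
have := Q_le t t1; rewrite leNgt => /negP; apply.
apply: le_lt_trans Qt; rewrite /t.
have -> // : Q 1 + W 1 / 2 * (1 - 2 * Q 1 / W 1 - 1) = 0.
by field; rewrite lt_eqF.
Qed.

(** Without a positive zero, [f] keeps one sign on the positive half-line by the intermediate value
    theorem. As the equation is linear, [f] or [- f] would then be a solution excluded by
    [no_positive_solution]. *)
Lemma exists_zero_of_ode (p : R) f f' f'' :
  2 < p ->
  (forall t : R, is_derive t (1:R) f (f' t)) ->
  (forall t : R, is_derive t (1:R) f' (f'' t)) ->
  (forall t, f'' t + t * f' t + p * f t = 0) -> f 0 = 0 ->
  exists2 t, 0 < t & f t = 0.
Proof.
move=> p2 df df' ode f0; apply: contrapT => nz.
have fnz (t : R) : 0 < t -> f t != 0.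
  by move=> t0; apply/eqP => ft; apply: nz; exists t.
have cf : continuous f.
  by move=> t; apply: differentiable_continuous; apply/derivable1_diffP; have [] := df t.
have sgn (s t : R) : 0 < s -> 0 < t -> 0 < f s -> 0 < f t.
  move=> s0 t0 fs; rewrite ltNge; apply/negP => ft.
  have m0 : 0 < Num.min s t by rewrite lt_min s0.
  have cfm : {within `[Num.min s t, Num.max s t], continuous f}.
    exact: continuous_subspaceT.
  have mm : Num.min s t <= Num.max s t by rewrite ge_min le_max lexx.
  have [|c] := @IVT _ _ _ _ 0 mm cfm.
    case: (leP s t) => _; rewrite ?ge_min ?le_max ft (ltW fs)//= ?orbT//.
  rewrite in_itv/= => /andP[mc _] fc; apply: nz; exists c => //.
  exact: lt_le_trans mc.
have [f1|f1] := ltP 0 (f 1).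
  by apply: (no_positive_solution _ _ _ _ p2 df df' ode f0) => t t0; exact: (sgn 1).
have dN (g g' : R -> R) : (forall t : R, is_derive t (1 : R) g (g' t)) ->
    forall t : R, is_derive t (1 : R) (fun x => - g x) (- g' t).
  by move=> dg t; apply: is_derive1_opp.
apply: (no_positive_solution _ _ _ _ p2 (dN _ _ df) (dN _ _ df')).
- by move=> t; have := ode t; lra.
- by rewrite f0 oppr0.
- move=> t t0; rewrite oppr_gt0 lt_neqAle fnz//= leNgt; apply/negP => ft.
  by move: f1; rewrite leNgt (sgn t).
Qed.

End oscillation.

(** * Gaussian envelopes and differentiation under the integral sign *)

Section gaussian_domination.
Context {R : realType}.
Local Notation mu := (@lebesgue_measure R).

Lemma integrable_gauss_sq (c : R) : 0 < c ->
  mu.-integrable setT (fun u : R => (expR (- (c * u ^+ 2)))%:E).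
Proof.
move=> c0.
have s0 : Num.sqrt c != 0 by rewrite gt_eqF// sqrtr_gt0.
have := integrable_affine _ 0 s0 _ (@integrableT_gauss R).
congr (is_true (integrable _ _ _)); apply/funext => u.
by rewrite /gauss_fun addr0 exprMn sqr_sqrtr ?(ltW c0)// mulNr.
Qed.

Lemma integrable_le_gauss (f : R -> R) (C : R) : measurable_fun setT f ->
  (forall u : R, `|f u| <= C * expR (- (u ^+ 2 / 16))) ->
  mu.-integrable setT (EFin \o f).
Proof.
move=> mf fC.
have i16 : mu.-integrable setT (fun u : R => (expR (- (16^-1 * u ^+ 2)))%:E).
  by apply: integrable_gauss_sq; rewrite invr_gt0.
apply: (le_integrable measurableT _ _ (integrableZl measurableT C i16)).
  exact/measurable_EFinP.
move=> u _ /=; rewrite lee_fin (le_trans (fC u))//.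
by rewrite (mulrC 16^-1) ler_norm.
Qed.

(** From [ln v <= v] comes [v ^ q <= exp (q v)], and [(|u| / 4 - 2 q) ^ 2 >= 0] gives
    [q |u| <= 4 q ^ 2 + u ^ 2 / 16]. *)
Lemma powR_le_gauss (q b u : R) : 0 <= q ->
  `|u - b| `^ q <= expR (q * `|b| + 4 * q ^+ 2) * expR (u ^+ 2 / 16).
Proof.
move=> q0; rewrite -expRD.
have nb : 0 <= q * `|b| by rewrite mulr_ge0.
have nu : q * `|u| <= 4 * q ^+ 2 + u ^+ 2 / 16.
  rewrite -(real_normK (num_real u)).
  have : 0 <= (`|u| / 4 - 2 * q) ^+ 2 by exact: sqr_ge0.
  by move: `|u| => v; nra.
have u2 : 0 <= u ^+ 2 by exact: sqr_ge0.
have q2 : 0 <= q ^+ 2 by exact: sqr_ge0.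
(* At base [0], [powR] takes the value [1] if [q = 0] and [0] otherwise, so it is at most [1]. *)
rewrite /powR normr_eq0; case: ifPn => [_|ub].
  apply: (@le_trans _ _ 1); first by case: (q == 0).
  by rewrite -[leLHS]expR0 ler_expR; lra.
rewrite ler_expR.
have ub0 : 0 < `|u - b| by rewrite normr_gt0.
have : ln `|u - b| <= `|u - b|.
  have := expR_ge1Dx (ln `|u - b|); rewrite lnK ?posrE//; lra.
move=> /(ler_wpM2l q0) /le_trans; apply.
have : q * `|u - b| <= q * (`|u| + `|b|) by rewrite ler_wpM2l// ler_normB.
lra.
Qed.

(** A single envelope, uniform in [x] near [x0], serves twice: it makes each [f x] integrable and it
    dominates the derivatives. *)
Lemma is_derive_under_gauss (f df : R -> R -> R) (x0 r C : R) : 0 < r ->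
  (forall x : R, measurable_fun setT (f x)) ->
  (forall x u : R, `|x - x0| < r -> `|f x u| <= C * expR (- (u ^+ 2 / 16))) ->
  (forall x u : R, `|x - x0| < r -> is_derive x (1 : R) (f ^~ u) (df x u)) ->
  (forall x u : R, `|x - x0| < r -> `|df x u| <= C * expR (- (u ^+ 2 / 16))) ->
  is_derive x0 (1 : R) (fun x => \int[mu]_u f x u) (\int[mu]_u df x0 u).
Proof.
move=> r0 mf fC fdf dfC.
have x0r : `]x0 - r, x0 + r[%classic x0.
  by rewrite /= in_itv/= ltrBlDr ltrDl r0.
have near x : `]x0 - r, x0 + r[%classic x -> `|x - x0| < r.
  by rewrite /= in_itv/= => xr; rewrite ltr_distl.
have C0 : 0 <= C.
  have x00 : `|x0 - x0| < r by rewrite subrr normr0.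
  rewrite -(pmulr_lge0 _ (expR_gt0 (- (0 ^+ 2 / 16)))).
  exact: le_trans (normr_ge0 _) (fC x0 0 x00).
have intf x : `]x0 - r, x0 + r[%classic x -> mu.-integrable setT (EFin \o f x).
  by move=> /near xr; apply: (integrable_le_gauss _ C) => // u; exact: fC.
have derf x (u : R) : `]x0 - r, x0 + r[%classic x -> setT u ->
    derivable (f^~ u) x 1.
  by move=> /near xr _; have [] := fdf x u xr.
pose G (u : R) := C * expR (- (u ^+ 2 / 16)).
have G0 u : 0 <= G u by rewrite mulr_ge0// expR_ge0.
have mG : measurable_fun setT G.
  apply: measurable_funM => //; apply: (measurableT_comp (@measurable_expR R)).
  by apply: measurable_funN; apply: measurable_funM.
have intG : mu.-integrable setT (EFin \o G).
  by apply: (integrable_le_gauss _ C) => // u; rewrite ger0_norm.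
have partialE x u : `]x0 - r, x0 + r[%classic x -> partial1of2 f x u = df x u.
  by move=> /near xr; rewrite partial1of2E; have [] := fdf x u xr.
have Gub x (u : R) : `]x0 - r, x0 + r[%classic x -> setT u ->
    `|partial1of2 f x u| <= G u.
  by move=> xr _; rewrite partialE// dfC// near.
apply: DeriveDef.
  exact: (derivable_under_integral measurableT x0r intf derf G0 intG Gub).
rewrite -derive1E.
rewrite (differentiation_under_integral measurableT x0r intf derf G0 intG Gub).
by apply: eq_Rintegral => u _; rewrite partialE.
Qed.

End gaussian_domination.

(** * Cosine transforms with a Gaussian factor, and their differential equation *)

Section gaussian_cosine_transform.
Context {R : realType}.
Local Notation mu := (@lebesgue_measure R).

(** The free phase [psi] includes the sine transform, at [psi = - (pi / 2)], and turns each
    derivative in [w] into a shift of [psi] by [pi / 2] with a further factor [u] in the weight. *)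
Definition gauss_cos (k : R -> R) (psi w : R) : R :=
  \int[mu]_u (k u * cos (w * u + psi) * expR (- (1 / 2 * u ^+ 2))).

Section weight.
Variables (k : R -> R) (q : R).
Hypotheses (mk : measurable_fun setT k) (q0 : 0 <= q).
Hypothesis kq : forall u, `|k u| <= `|u| `^ q.

(** The power costs at most [exp (u ^ 2 / 16)], half of the decay at rate [1 / 8]. Admitting every
    rate from [1 / 8] on, not only [1 / 2], leaves room for the dilations in [gauss_cos_ode]. *)
Lemma weight_le_gauss (c u : R) : 1 / 8 <= c ->
  `|k u| * expR (- (c * u ^+ 2)) <= expR (4 * q ^+ 2) * expR (- (u ^+ 2 / 16)).
Proof.
move=> c8; have := powR_le_gauss _ 0 u q0.
rewrite subr0 normr0 mulr0 add0r => H.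
apply: (@le_trans _ _ (expR (4 * q ^+ 2) * expR (u ^+ 2 / 16) *
    expR (- (c * u ^+ 2)))).
  by rewrite ler_wpM2r ?expR_ge0// (le_trans (kq u)).
rewrite -mulrA ler_wpM2l ?expR_ge0// -expRD ler_expR.
have := sqr_ge0 u; nra.
Qed.

Lemma norm_mul_weight u : `|u * k u| <= `|u| `^ (q + 1).
Proof.
rewrite normrM.
have -> : `|u| `^ (q + 1) = `|u| * `|u| `^ q.
  by rewrite -(@mulr_powRB1 _ `|u| (q + 1)) ?addrK// ltr_wpDl.
by rewrite ler_wpM2l.
Qed.

Lemma measurable_gauss_cos_integrand (psi w c : R) :
  measurable_fun setT
    (fun u : R => k u * cos (w * u + psi) * expR (- (c * u ^+ 2))).
Proof.
apply: measurable_funM.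
  apply: measurable_funM => //; apply: measurableT_comp.
    by apply: continuous_measurable_fun; exact: continuous_cos.
  by apply: measurable_funD => //; exact: measurable_funM.
apply: (measurableT_comp (@measurable_expR R)).
by apply: measurable_funN; apply: measurable_funM.
Qed.

Lemma gauss_cos_integrand_le (psi w c u : R) : 1 / 8 <= c ->
  `|k u * cos (w * u + psi) * expR (- (c * u ^+ 2))| <=
  expR (4 * q ^+ 2) * expR (- (u ^+ 2 / 16)).
Proof.
move=> c8; apply: le_trans (weight_le_gauss c u c8).
rewrite normrM (ger0_norm (expR_ge0 _)) ler_wpM2r ?expR_ge0//.
by rewrite normrM ler_piMr// cos_max.
Qed.

Lemma integrable_gauss_cos (psi w : R) : mu.-integrable setT
  (fun u => (k u * cos (w * u + psi) * expR (- (1 / 2 * u ^+ 2)))%:E).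
Proof.
apply: (integrable_le_gauss _ (expR (4 * q ^+ 2))).
  exact: measurable_gauss_cos_integrand.
by move=> u; apply: gauss_cos_integrand_le; lra.
Qed.

End weight.

Lemma is_derive_gauss_cos (k : R -> R) (q psi w : R) :
  measurable_fun setT k -> 0 <= q -> (forall u, `|k u| <= `|u| `^ q) ->
  is_derive w (1 : R) (gauss_cos k psi)
    (gauss_cos (fun u => u * k u) (psi + pi / 2) w).
Proof.
move=> mk q0 kq.
have q10 : 0 <= q + 1 by rewrite addr_ge0.
have kq1 := norm_mul_weight _ _ q0 kq.
have h18 : 1 / 8 <= 1 / 2 :> R by lra.
apply: (@is_derive_under_gauss R
  (fun w u => k u * cos (w * u + psi) * expR (- (1 / 2 * u ^+ 2)))
  (fun w u => u * k u * cos (w * u + (psi + pi / 2)) * expR (- (1 / 2 * u ^+ 2)))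
  w 1 (expR (4 * q ^+ 2) + expR (4 * (q + 1) ^+ 2))) => //.
- by move=> x; exact: measurable_gauss_cos_integrand.
- move=> x u _; rewrite [leRHS]mulrDl.
  rewrite (le_trans (gauss_cos_integrand_le _ _ q0 kq psi x _ u h18))//.
  by rewrite lerDl mulr_ge0 ?expR_ge0.
- move=> x u _.
  have dc : is_derive x (1 : R) (fun y => cos (y * u + psi)) (- sin (x * u + psi) * u).
    apply: is_derive1_cos; apply: is_derive_eq; rewrite /GRing.scale /=; ring.
  apply: is_derive_eq; rewrite /GRing.scale /=.
  by rewrite addrA cosDpihalf; ring.
- move=> x u _; rewrite [leRHS]mulrDl.
  have /= H := gauss_cos_integrand_le _ _ q10 kq1 (psi + pi / 2) x _ u h18.
  rewrite (le_trans H)//.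
  by rewrite lerDr mulr_ge0 ?expR_ge0.
Qed.

(* The equation is the derivative at [tau = 0] of the scaling identity
   obtained by the substitution [u := expR tau * u]. *)
Lemma gauss_cos_ode (k : R -> R) (q psi w : R) :
  measurable_fun setT k -> 0 <= q -> (forall u, `|k u| <= `|u| `^ q) ->
  (forall tau u, k (expR tau * u) = expR (q * tau) * k u) ->
  gauss_cos (fun u => u * (u * k u)) (psi + pi / 2 + pi / 2) w +
  w * gauss_cos (fun u => u * k u) (psi + pi / 2) w +
  (q + 1) * gauss_cos k psi w = 0.
Proof.
move=> mk q0 kq hk.
have q10 : 0 <= q + 1 by rewrite addr_ge0.
have q20 : 0 <= q + 1 + 1 by rewrite addr_ge0.
have kq1 := norm_mul_weight _ _ q0 kq.
have kq2 := norm_mul_weight _ _ q10 kq1.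
pose T (tau : R) := \int[mu]_u
  (k u * cos (w * u + psi) * expR (- (expR (2 * tau) / 2 * u ^+ 2))).
(* The substitution contributes [expR tau] through the measure and [expR (q * tau)] through the
   homogeneity of [k], hence the exponent [q + 1]. *)
have scaling tau : expR ((q + 1) * tau) * T tau =
    gauss_cos k psi (w * expR (- tau)).
  have a0 : expR tau != 0 by rewrite gt_eqF// expR_gt0.
  have intk := integrable_gauss_cos _ _ mk q0 kq psi (w * expR (- tau)).
  have E1 u : w * expR (- tau) * (expR tau * u) = w * u.
    by rewrite expRN; field.
  have E2 u : 1 / 2 * (expR tau * u) ^+ 2 = expR (2 * tau) / 2 * u ^+ 2.
    by rewrite (_ : 2 * tau = tau + tau) ?expRD; ring.
  have intA := integrable_affine _ 0 a0 _ intk.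
  rewrite [RHS]/gauss_cos -(Rintegral_affine _ 0 a0 _ intk).
  rewrite (gtr0_norm (expR_gt0 _)).
  have -> : T tau = expR (- (q * tau)) * \int[mu]_u
      (k (expR tau * u + 0) * cos (w * expR (- tau) * (expR tau * u + 0) + psi) *
       expR (- (1 / 2 * (expR tau * u + 0) ^+ 2))).
    rewrite -RintegralZl//; apply: eq_Rintegral => u _.
    rewrite addr0 hk E1 E2 !mulrA -expRD addNr expR0 mul1r//.
  by rewrite mulrA -expRD; congr (expR _ * _); ring.
(* For small [tau] the dilated Gaussian keeps a rate of at least [1 / 8], as the uniform bounds
   require. *)
have near tau : `|tau - 0| < 1 / 4 -> 1 / 8 <= expR (2 * tau) / 2 /\ expR (2 * tau) <= 4.
  rewrite subr0 ltr_norml => /andP[t1 t2].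
  have e1 := expR_ge1Dx (2 * tau); have e2 := expR_ge1Dx (- (2 * tau)).
  have e3 := expRxMexpNx_1 (2 * tau); have e4 := expR_gt0 (2 * tau).
  by split; [lra|nra].
(* The first term bounds the integrand. The second bounds its [tau]-derivative, whose weight grows
   with exponent [q + 2] and whose factor [expR (2 * tau)] is at most [4]. *)
pose C := expR (4 * q ^+ 2) + 4 * expR (4 * (q + 1 + 1) ^+ 2).
have dT : is_derive (0 : R) (1 : R) T
    (gauss_cos (fun u => u * (u * k u)) (psi + pi / 2 + pi / 2) w).
  apply: is_derive_eq.
    apply: (@is_derive_under_gauss R
      (fun tau u => k u * cos (w * u + psi) *
        expR (- (expR (2 * tau) / 2 * u ^+ 2)))
      (fun tau u => - expR (2 * tau) * (u * (u * k u) * cos (w * u + psi) *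
        expR (- (expR (2 * tau) / 2 * u ^+ 2))))
      0 (1 / 4) C) => //.
  - by move=> x; exact: measurable_gauss_cos_integrand.
  - move=> x u /near[h _]; rewrite [leRHS]mulrDl.
    rewrite (le_trans (gauss_cos_integrand_le _ _ q0 kq psi w _ u h))//.
    by rewrite lerDl !mulr_ge0 ?expR_ge0.
  - move=> x u _.
    have de : is_derive x (1 : R)
        (fun y => expR (- (expR (2 * y) / 2 * u ^+ 2)))
        (expR (- (expR (2 * x) / 2 * u ^+ 2)) * - (expR (2 * x) * u ^+ 2)).
      apply: is_derive1_expR.
      have de2 : is_derive x (1 : R) (fun y => expR (2 * y)) (expR (2 * x) * 2).
        apply: is_derive1_expR; apply: is_derive_eq; rewrite /GRing.scale /=; ring.
      apply: is_derive_eq; rewrite /GRing.scale /=. by rewrite !mulr0 !add0r; field.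
    apply: (is_derive_eq (is_derive1_mul _ _ _ _ _
      (is_derive1_cst (k u * cos (w * u + psi)) x) de)).
    ring.
  - move=> x u /near[h h4]; rewrite [leRHS]mulrDl.
    rewrite normrM normrN (ger0_norm (expR_ge0 _)).
    apply: (@le_trans _ _ (4 * (expR (4 * (q + 1 + 1) ^+ 2) * expR (- (u ^+ 2 / 16))))).
      rewrite ler_pM ?expR_ge0//.
      exact: (gauss_cos_integrand_le _ _ q20 kq2 psi w _ u h).
    by rewrite mulrA lerDr mulr_ge0 ?expR_ge0.
  (* Two shifts by [pi / 2] change the sign of the cosine, which absorbs the minus sign from
     differentiating the Gaussian. *)
  apply: eq_Rintegral => u _.
  by rewrite mulr0 expR0 addrA addrA !cosDpihalf sinDpihalf; ring.
have dL : is_derive (0 : R) (1 : R) (fun tau => expR ((q + 1) * tau) * T tau)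
    ((q + 1) * gauss_cos k psi w +
     gauss_cos (fun u => u * (u * k u)) (psi + pi / 2 + pi / 2) w).
  have de : is_derive (0 : R) (1 : R) (fun tau => expR ((q + 1) * tau)) (q + 1).
    have dl : is_derive (0 : R) (1 : R) (fun tau => (q + 1) * tau) (q + 1).
      by apply: is_derive_eq; rewrite /GRing.scale /=; ring.
    apply: (is_derive_eq (is_derive1_expR _ _ _ dl)).
    by rewrite mulr0 expR0 mul1r.
  apply: is_derive_eq; rewrite /GRing.scale /= mulr0 expR0 mul1r.
  have -> : T 0 = gauss_cos k psi w by have := scaling 0; rewrite mulr0 oppr0 expR0 mul1r mulr1.
  ring.
have dR : is_derive (0 : R) (1 : R)
    (fun tau => gauss_cos k psi (w * expR (- tau)))
    (gauss_cos (fun u => u * k u) (psi + pi / 2) w * - w).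
  have dw : is_derive (0 : R) (1 : R) (fun tau => w * expR (- tau)) (- w).
    have de : is_derive (0 : R) (1 : R) (fun tau => expR (- tau)) (expR (- 0) * - 1).
      by apply: is_derive1_expR; exact: is_derive1_opp.
    apply: is_derive_eq; rewrite /GRing.scale /= oppr0 expR0; ring.
  have dg := is_derive_gauss_cos k q psi w mk q0 kq.
  apply: (is_derive1_comp (f := gauss_cos k psi) (g := fun tau => w * expR (- tau))).
  by rewrite oppr0 expR0 mulr1.
have E : (fun tau => expR ((q + 1) * tau) * T tau) =
    (fun tau => gauss_cos k psi (w * expR (- tau))) by apply/funext.
rewrite E in dL.
have := @derive_val _ _ _ _ _ _ _ dL.
by rewrite (@derive_val _ _ _ _ _ _ _ dR); lra.
Qed.

End gaussian_cosine_transform.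

(** * Odd weights, and the zero of the sine transform of [odd_powR] *)

Section odd_weight.
Context {R : realType}.
Local Notation mu := (@lebesgue_measure R).

(** The addition formula for the cosine splits any phase into the cosine and the sine transform. *)
Lemma gauss_cos_phase (k : R -> R) (q psi w : R) :
  measurable_fun setT k -> 0 <= q -> (forall u, `|k u| <= `|u| `^ q) ->
  gauss_cos k psi w =
  cos psi * gauss_cos k 0 w - sin psi * gauss_cos k (- (pi / 2)) w.
Proof.
move=> mk q0 kq.
have int0 := integrable_gauss_cos _ _ mk q0 kq 0 w.
have int1 := integrable_gauss_cos _ _ mk q0 kq (- (pi / 2)) w.
rewrite /gauss_cos -RintegralZl// -RintegralZl// -RintegralB//=.
- apply: eq_Rintegral => u _.
  by rewrite addr0 cosBpihalf cosD; ring.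
- by have := integrableZl measurableT (cos psi) int0.
- by have := integrableZl measurableT (sin psi) int1.
Qed.

(** The reflection [u := - u] changes the sign of the integrand. *)
Lemma gauss_cos_odd (k : R -> R) (q w : R) :
  measurable_fun setT k -> 0 <= q -> (forall u, `|k u| <= `|u| `^ q) ->
  (forall u, k (- u) = - k u) -> gauss_cos k 0 w = 0.
Proof.
move=> mk q0 kq oddk.
have int0 := integrable_gauss_cos _ _ mk q0 kq 0 w.
have N1 : -1 != 0 :> R by rewrite oppr_eq0.
have : gauss_cos k 0 w = - gauss_cos k 0 w; last by lra.
rewrite [LHS]/gauss_cos -(Rintegral_affine _ 0 N1 _ int0).
rewrite normrN1 mul1r -[RHS]mulN1r -RintegralZl//.
apply: eq_Rintegral => u _.
by rewrite mulN1r !addr0 oddk mulrN cosN sqrrN; ring.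
Qed.

(** All phases are needed at once, because the phase seen after conditioning on [Y = y] varies with
    [y] and [theta]. *)
Lemma gauss_cos_odd_eq0 (k : R -> R) (q w : R) :
  measurable_fun setT k -> 0 <= q -> (forall u, `|k u| <= `|u| `^ q) ->
  (forall u, k (- u) = - k u) -> gauss_cos k (- (pi / 2)) w = 0 ->
  forall psi, gauss_cos k psi w = 0.
Proof.
move=> mk q0 kq oddk k0 psi; rewrite (gauss_cos_phase _ q)// k0.
by rewrite (gauss_cos_odd _ q)// !mulr0 subr0.
Qed.

Definition odd_powR (p u : R) : R := u * `|u| `^ (p - 2).

Variable p : R.
Hypothesis p2 : 2 < p.

Lemma measurable_odd_powR : measurable_fun setT (odd_powR p).
Proof.
apply: measurable_funM => //.
by apply: (measurableT_comp (measurable_powR (p - 2))); exact: normr_measurable.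
Qed.

Lemma norm_odd_powR u : `|odd_powR p u| = `|u| `^ (p - 1).
Proof.
rewrite /odd_powR normrM (ger0_norm (powR_ge0 _ _)).
rewrite (_ : p - 2 = p - 1 - 1); last by ring.
by rewrite mulr_powRB1// subr_gt0 (lt_trans _ p2)// ltr1n.
Qed.

Lemma odd_powRN u : odd_powR p (- u) = - odd_powR p u.
Proof. by rewrite /odd_powR normrN mulNr. Qed.

Lemma odd_powR_homogeneous tau u :
  odd_powR p (expR tau * u) = expR ((p - 1) * tau) * odd_powR p u.
Proof.
rewrite /odd_powR normrM (ger0_norm (expR_ge0 _)) powRM ?expR_ge0//.
rewrite -expRM mulrACA -expRD; congr (expR _ * _); ring.
Qed.

(** The weight is homogeneous of degree [q = p - 1], so the coefficient [q + 1] in [gauss_cos_ode]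
    is the [p] of the oscillation result; the value at [0] vanishes because [cos (pi / 2) = 0]. *)
Lemma exists_zero_gauss_sin :
  exists2 w, 0 < w & gauss_cos (odd_powR p) (- (pi / 2)) w = 0.
Proof.
have q0 : 0 <= p - 1 by rewrite subr_ge0 ltW// (lt_trans _ p2)// ltr1n.
have q1 : 0 <= p - 1 + 1 by rewrite addr_ge0.
have mk := measurable_odd_powR.
have kq u : `|odd_powR p u| <= `|u| `^ (p - 1) by rewrite norm_odd_powR.
have mk1 : measurable_fun setT (fun u : R => u * odd_powR p u).
  exact: measurable_funM.
apply: (exists_zero_of_ode _ _ _ _ p2).
- by move=> t; exact: is_derive_gauss_cos mk q0 kq.
- by move=> t; exact: is_derive_gauss_cos mk1 q1 (norm_mul_weight _ _ q0 kq).
- move=> t.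
  have := gauss_cos_ode _ _ (- (pi / 2)) t mk q0 kq odd_powR_homogeneous.
  by rewrite (subrK 1 p).
- rewrite /gauss_cos; transitivity (\int[mu]_(u in [set: R]) (0 : R)).
    by apply: eq_Rintegral => u _; rewrite mul0r add0r cosN cos_pihalf mulr0 mul0r.
  by rewrite Rintegral_cst// mul0r.
Qed.

End odd_weight.

(** * Derivatives of the Gaussian as cosine transforms, and Hermite zeros *)

Section gaussian_derivatives.
Context {R : realType}.
Local Notation mu := (@lebesgue_measure R).

Lemma constant_of_derive0 (f : R -> R) :
  (forall t : R, is_derive t (1 : R) f 0) -> forall t, f t = f 0.
Proof.
move=> df t.
have [t0|t0|->//] := ltgtP t 0.
- have [c _] := mean_value _ _ _ _ t0 (fun x _ => df x).
  by rewrite mul0r => /eqP; rewrite subr_eq0 => /eqP.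
- have [c _] := mean_value _ _ _ _ t0 (fun x _ => df x).
  by rewrite mul0r => /eqP; rewrite subr_eq0 => /eqP.
Qed.

Let one_le (u : R) : `|1 : R| <= `|u| `^ 0.
Proof. by rewrite normr1 powRr0. Qed.

Lemma measurable_exprn n : measurable_fun setT (fun u : R => u ^+ n).
Proof. exact: measurable_funX. Qed.

Let exprn_le n (u : R) : `|u ^+ n| <= `|u| `^ n%:R.
Proof. by rewrite powR_mulrn// normrX. Qed.

(** For weight [1] the equation [A'' + t A' + A = 0] says that [A' + t A] is constant, with value
    [0] at the origin. Then [A' = - t A], so [A exp (t ^ 2 / 2)] is constant too. *)
Lemma gauss_cos_cst1 (w : R) :
  gauss_cos (fun=> 1) 0 w = gauss_cos (fun=> 1) 0 0 * expR (- (w ^+ 2 / 2)).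
Proof.
have m1 : measurable_fun setT (fun _ : R => 1 : R) by [].
have mid : measurable_fun setT (fun u : R => u * 1) by exact: measurable_funM.
have le1 := norm_mul_weight _ _ (lexx 0) one_le.
have le01 : 0 <= 0 + 1 :> R by rewrite add0r.
set A := gauss_cos (fun=> 1) 0.
pose A' := gauss_cos (fun u : R => u * 1) (0 + pi / 2).
pose A'' := gauss_cos (fun u : R => u * (u * 1)) (0 + pi / 2 + pi / 2).
have dA (t : R) : is_derive t (1 : R) A (A' t).
  exact: is_derive_gauss_cos m1 (lexx 0) one_le.
have dA' (t : R) : is_derive t (1 : R) A' (A'' t).
  exact: is_derive_gauss_cos mid le01 le1.
have ode t : A'' t + t * A' t + A t = 0.
  rewrite -[X in _ + X]mul1r -[X in X * A t](add0r 1).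
  apply: (gauss_cos_ode _ _ _ _ m1 (lexx 0) one_le).
  by move=> tau u; rewrite mul0r expR0 mulr1.
have dB (t : R) : is_derive t (1 : R) (fun t => A' t + t * A t) 0.
  have H1 := dA t; have H2 := dA' t.
  apply: is_derive_eq; rewrite /GRing.scale /=.
  by have := ode t; lra.
have A'0 : A' 0 = 0.
  rewrite /A' /gauss_cos; transitivity (\int[mu]_(u in [set: R]) (0 : R)).
    by apply: eq_Rintegral => u _; rewrite mul0r !add0r cos_pihalf mulr0 mul0r.
  by rewrite Rintegral_cst// mul0r.
have A'E t : A' t = - (t * A t).
  have := constant_of_derive0 _ dB t; rewrite /= A'0 mul0r; lra.
have dE (t : R) : is_derive t (1 : R) (fun t => A t * expR (t ^+ 2 / 2)) 0.
  have H1 := dA t.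
  have dq : is_derive t (1 : R) (fun t => t ^+ 2 / 2) t.
    by apply: is_derive_eq; rewrite /GRing.scale /=; field.
  apply: (is_derive_eq (is_derive1_mul _ _ _ _ _ H1 (is_derive1_expR _ _ _ dq))).
  by rewrite A'E; ring.
have := constant_of_derive0 _ dE w.
rewrite /= expr0n/= mul0r expR0 mulr1 => <-.
by rewrite -mulrA -expRD subrr expR0 mulr1.
Qed.

(** A dilation relates this value to the integral of [gauss_fun], which is [sqrt pi]. *)
Lemma gauss_cos_cst1_neq0 : gauss_cos (fun=> 1) 0 (0 : R) != 0.
Proof.
have s0 : (Num.sqrt (1 / 2) : R) != 0 by rewrite gt_eqF// sqrtr_gt0; lra.
have -> : gauss_cos (fun=> 1) 0 (0 : R) =
    \int[mu]_u gauss_fun (Num.sqrt (1 / 2) * u + 0).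
  apply: eq_Rintegral => u _.
  by rewrite mul0r add0r cos0 mulr1 mul1r addr0 /gauss_fun exprMn sqr_sqrtr.
have := Rintegral_affine _ 0 s0 _ (@integrableT_gauss R).
rewrite {2}/Rintegral integralT_gauss /=.
move=> E; apply: contraTneq isT => J0.
move: E; rewrite J0 mulr0 => /esym/eqP.
by rewrite sqrtr_eq0 leNgt pi_gt0.
Qed.

(** Induction from [gauss_cos_cst1]: each derivative adds a factor [u] and a quarter turn of the
    phase. *)
Lemma derive1n_gauss n (w : R) :
  derive1n n (fun t : R => expR (- (t ^+ 2 / 2))) w =
  (gauss_cos (fun=> 1) 0 0)^-1 * gauss_cos (fun u => u ^+ n) (pi / 2 *+ n) w.
Proof.
have K0 := gauss_cos_cst1_neq0.
elim: n w => [|n IH] w.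
  rewrite mulr0n /=.
  have -> : gauss_cos (fun u : R => u ^+ 0) 0 w = gauss_cos (fun=> 1) 0 w.
    by [].
  by rewrite (gauss_cos_cst1 w) mulKf.
rewrite derive1nS (funext IH).
rewrite derive1E.
have dg := is_derive_gauss_cos _ _ (pi / 2 *+ n) w (measurable_exprn n)
  (ler0n R n) (exprn_le n).
have := is_derive1_mul _ _ _ _ _ (is_derive1_cst (gauss_cos (fun=> 1) 0 0)^-1 w) dg.
move=> [_ ->]; rewrite mul0r add0r (mulrSr (pi / 2) n).
by congr (_ * _); apply: eq_Rintegral => u _; rewrite (exprS u n).
Qed.

(** For even [p] the weight [odd_powR p] is the monomial of degree [p - 1], so the Hermite
    polynomial is a nowhere zero factor times its transform at phase [(p - 1) pi / 2]. Oddness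
    leaves only the sine part of that. *)
Lemma gauss_sin_hermite_zero (n : nat) (w : R) : hermite_He (2 * n.+1).-1 w = 0 ->
  gauss_cos (odd_powR (2 * n.+1)%:R) (- (pi / 2)) w = 0.
Proof.
have -> : (2 * n.+1).-1 = (n.*2).+1 by rewrite mulnS mul2n.
rewrite /hermite_He derive1n_gauss => /eqP.
rewrite !mulf_eq0 expR_eq0 signr_eq0 invr_eq0 (negbTE gauss_cos_cst1_neq0) !orFb.
have kE : (fun u : R => u ^+ (n.*2).+1) = odd_powR (2 * n.+1)%:R.
  apply/funext => u; rewrite /odd_powR exprS; congr *%R.
  have -> : (2 * n.+1)%:R - 2 = n.*2%:R :> R by rewrite mulnS natrD mul2n; ring.
  by rewrite powR_mulrn// -normrX ger0_norm// -muln2 exprM sqr_ge0.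
have m2n := measurable_exprn (n.*2).+1.
rewrite (gauss_cos_phase _ _ _ _ m2n (ler0n R _) (exprn_le _)).
rewrite (gauss_cos_odd _ _ _ m2n (ler0n R _) (exprn_le _)); last first.
  by move=> u; rewrite exprNn -signr_odd /= odd_double expr1 mulN1r.
rewrite mulr0 sub0r oppr_eq0 mulf_eq0 kE => /orP[|/eqP//].
have -> : pi / 2 *+ (n.*2).+1 = pi *+ n + pi / 2 :> R.
  rewrite mulrS addrC -addnn mulrnDr; congr (_ + _).
  by rewrite -mulrnDl -splitr.
rewrite sinDpihalf => /eqP c0; exfalso.
(* The coefficient of the sine transform is a sign, so it cannot be the factor that vanishes. *)
have : `|cos (pi *+ n : R)| = 1.
  elim: n {c0 kE m2n} => [|n IH]; first by rewrite cos0 normr1.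
  by rewrite mulrSr cosDpi normrN.
by rewrite c0 normr0 => /esym/eqP; rewrite oner_eq0.
Qed.

End gaussian_derivatives.

(** * Minimality of the loss at a fixed observation *)

Section power_loss.
Context {R : realType}.
Local Notation mu := (@lebesgue_measure R).

Lemma odd_powR_mulr (p u : R) : 2 < p -> odd_powR p u * u = `|u| `^ p.
Proof.
move=> p2; have p0 : 0 < p by exact: lt_trans p2.
rewrite /odd_powR mulrAC -expr2 -(real_normK (num_real u)) expr2 -mulrA.
rewrite (_ : p - 2 = p - 1 - 1); last by ring.
by rewrite !mulr_powRB1// subr_gt0 (lt_trans _ p2)// ltr1n.
Qed.

(* Young's inequality bounds [odd_powR p u * (u - b)]. *)
Lemma powR_norm_tangent (p b u : R) : 2 < p ->
  `|u| `^ p - p * b * odd_powR p u <= `|u - b| `^ p.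
Proof.
move=> p2.
have p0 : 0 < p by exact: lt_trans p2.
have p1 : 0 < p - 1 by rewrite subr_gt0 (lt_trans _ p2)// ltr1n.
have pV : 0 < p / (p - 1) by rewrite divr_gt0.
have conj : (p / (p - 1))^-1 + p^-1 = 1 by field; rewrite !gt_eqF.
(* The exponents [p / (p - 1)] and [p], applied to [|u| ^ (p - 1)] and [|u - b|], produce exactly
   [|u| ^ p] and [|u - b| ^ p]. *)
have := conjugate_powR (powR_ge0 `|u| (p - 1)) (normr_ge0 (u - b)) pV p0 conj.
rewrite -powRrM (_ : (p - 1) * (p / (p - 1)) = p); last first.
  by field; rewrite gt_eqF.
have := odd_powR_mulr _ u p2.
set U := `|u| `^ p; set V := `|u - b| `^ p => uE.
have : odd_powR p u * (u - b) <= `|u| `^ (p - 1) * `|u - b|.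
  by rewrite (le_trans (ler_norm _))// normrM norm_odd_powR.
rewrite mulrBr uE => /le_trans /[apply].
rewrite invf_div mulrA -mulrDl ler_pdivlMr//.
move: (odd_powR p u) => K; lra.
Qed.

Variables (p rho psi w : R).
Hypotheses (p2 : 2 < p) (rho1 : -1 <= rho <= 1).
Hypothesis zero : gauss_cos (odd_powR p) psi w = 0.

Let weight (u : R) := expR (- (1 / 2 * u ^+ 2)) * (1 + rho * cos (w * u + psi)).

Lemma tilt_bounds (x : R) : 0 <= 1 + rho * cos x <= 2.
Proof.
have /andP[r1 r2] := rho1.
have c1 := cos_geN1 x; have c2 := cos_le1 x.
by apply/andP; split; nra.
Qed.

Let measurable_weight : measurable_fun setT weight.
Proof.
apply: measurable_funM.
  apply: (measurableT_comp (@measurable_expR R)).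
  by apply: measurable_funN; apply: measurable_funM.
apply: measurable_funD => //; apply: measurable_funM => //.
apply: measurableT_comp.
  by apply: continuous_measurable_fun; exact: continuous_cos.
by apply: measurable_funD => //; exact: measurable_funM.
Qed.

Let weight_ge0 u : 0 <= weight u.
Proof. by rewrite mulr_ge0 ?expR_ge0//; have /andP[] := tilt_bounds (w * u + psi). Qed.

Let integrable_loss (b : R) :
  mu.-integrable setT (EFin \o (fun u => `|u - b| `^ p * weight u)).
Proof.
have p0 : 0 <= p by exact: ltW (lt_trans _ p2).
apply: (integrable_le_gauss _ (expR (p * `|b| + 4 * p ^+ 2) * 2)).
  apply: measurable_funM => //.
  apply: (measurableT_comp (measurable_powR p)).
  apply: measurableT_comp; first exact: normr_measurable.
  exact: measurable_funB.
move=> u; rewrite ger0_norm; last exact: mulr_ge0 (powR_ge0 _ _) (weight_ge0 u).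
have /andP[t0 t2] := tilt_bounds (w * u + psi).
(* The growing factor is matched with the power [|u - b| ^ p], the decaying one with the Gaussian in
   [weight]. *)
have -> : expR (- (u ^+ 2 / 16)) =
    expR (u ^+ 2 / 16) * expR (- (u ^+ 2 / 8)).
  by rewrite -expRD; congr expR; field.
rewrite (_ : _ * 2 * _ = expR (p * `|b| + 4 * p ^+ 2) * expR (u ^+ 2 / 16) *
    (expR (- (u ^+ 2 / 8)) * 2)); last by ring.
apply: ler_pM; [exact: powR_ge0|exact: weight_ge0|exact: powR_le_gauss|].
apply: ler_pM; [exact: expR_ge0|exact: t0| |exact: t2].
rewrite ler_expR.
have := sqr_ge0 u; lra.
Qed.

Let integrable_odd (phi v : R) : mu.-integrable setT (EFin \o
  (fun u => odd_powR p u * cos (v * u + phi) * expR (- (1 / 2 * u ^+ 2)))).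
Proof.
apply: (integrable_gauss_cos _ (p - 1)).
- exact: measurable_odd_powR.
- by rewrite subr_ge0 ltW// (lt_trans _ p2)// ltr1n.
- by move=> u; rewrite norm_odd_powR.
Qed.

(** The constant part of the tilt gives a transform at frequency [0], null by oddness; the
    oscillating part is null by [zero]. *)
Let integral_odd : \int[mu]_u (odd_powR p u * weight u) = 0.
Proof.
have -> : \int[mu]_u (odd_powR p u * weight u) =
    gauss_cos (odd_powR p) 0 0 + rho * gauss_cos (odd_powR p) psi w.
  rewrite /gauss_cos -RintegralZl//.
  rewrite -RintegralD//.
    apply: eq_Rintegral => u _ /=.
    by rewrite mul0r addr0 cos0 /weight; ring.
  by have := integrableZl measurableT rho (integrable_odd psi w).
rewrite zero mulr0 addr0; apply: (gauss_cos_odd _ (p - 1)).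
- exact: measurable_odd_powR.
- by rewrite subr_ge0 ltW// (lt_trans _ p2)// ltr1n.
- by move=> u; rewrite norm_odd_powR.
- exact: odd_powRN.
Qed.

Let integrable_odd_weight :
  mu.-integrable setT (EFin \o (fun u => odd_powR p u * weight u)).
Proof.
have H := integrableD measurableT (integrable_odd 0 0)
  (integrableZl measurableT rho (integrable_odd psi w)).
move: H; congr (is_true (integrable _ _ _)); apply/funext => u /=.
rewrite -EFinM -EFinD; congr EFin.
by rewrite mul0r addr0 cos0 /weight; ring.
Qed.

(** The tangent inequality is integrated against the nonnegative [weight], and its linear term
    disappears by [integral_odd]. *)
Lemma power_loss_min (b : R) :
  (\int[mu]_u (`|u| `^ p * weight u)%:E <=
   \int[mu]_u (`|u - b| `^ p * weight u)%:E)%E.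
Proof.
have i0 : mu.-integrable setT (EFin \o (fun u => `|u| `^ p * weight u)).
  have := integrable_loss 0; congr (is_true (integrable _ _ _)).
  by apply/funext => u /=; rewrite subr0.
have ib := integrable_loss b.
have ik := integrableZl measurableT (p * b) integrable_odd_weight.
have E : \int[mu]_u (`|u| `^ p * weight u - p * b * (odd_powR p u * weight u)) =
    \int[mu]_u (`|u| `^ p * weight u).
  by rewrite RintegralB// RintegralZl// integral_odd mulr0 subr0.
rewrite -(fineK (integrable_fin_num measurableT i0)).
rewrite -(fineK (integrable_fin_num measurableT ib)) lee_fin.
rewrite [leLHS](esym E).
apply: le_Rintegral => //.
  by have := integrableB measurableT i0 ik.
move=> u _; rewrite mulrA -mulrBl ler_wpM2r//.
exact: powR_norm_tangent.
Qed.

End power_loss.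

(** * Joint law of a signal and its noisy observation *)

Section independent_densities.
Local Open Scope ereal_scope.
Context d (T : measurableType d) (R : realType) (P : probability T R).
Local Notation mu := (@lebesgue_measure R).
Local Notation RR := (measurableTypeR R).
Variables (X Z : T -> RR) (f h : R -> R).
Hypotheses (mX : measurable_fun [set: T] X) (mZ : measurable_fun [set: T] Z).
Hypotheses (mf : measurable_fun [set: RR] f) (f0 : forall x, (0 <= f x)%R).
Hypotheses (mh : measurable_fun [set: RR] h) (h0 : forall x, (0 <= h x)%R).
Hypothesis PX : forall A, measurable A -> P (X @^-1` A) = \int[mu]_(x in A) (f x)%:E.
Hypothesis PZ : forall A, measurable A -> P (Z @^-1` A) = \int[mu]_(x in A) (h x)%:E.
Hypothesis XZ : indep_rv P X Z.

Let mX_mixin := isMeasurableFun.Build _ _ _ _ _ mX.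
Let mZ_mixin := isMeasurableFun.Build _ _ _ _ _ mZ.
Let mfunX : {mfun T >-> RR} := HB.pack X mX_mixin.
Let mfunZ : {mfun T >-> RR} := HB.pack Z mZ_mixin.

Let XZ_pair (t : T) : RR * RR := (X t, Z t).

Let measurable_XZ : measurable_fun [set: T] XZ_pair.
Proof. exact: measurable_fun_pair. Qed.

Let joint : {measure set (RR * RR)%type -> \bar R} :=
  measure_function_pushforward__canonical__measure_function_Measure
    P measurable_XZ.

(** Independence gives agreement on rectangles, which determine the product measure. *)
Let jointE : forall A, measurable A ->
  (distribution P mfunX \x distribution P mfunZ) A = joint A.
Proof.
apply: product_measure_unique => A B mA mB.
by rewrite /joint /= /pushforward -XZ.
Qed.

(** The translation [z = y - x] brings in the noise density [h (y - x)], and Tonelli then puts the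
    observation [y] outside, so that estimators can be compared for each [y] separately. *)
Lemma ge0_integral_indep_sum (F : RR * RR -> \bar R) :
  measurable_fun [set: RR * RR] F -> (forall xy, 0 <= F xy) ->
  \int[P]_t F (X t, X t + Z t)%R =
  \int[mu]_y \int[mu]_x (F (x, y) * (h (y - x) * f x)%:E).
Proof.
move=> mF F0.
pose G (xz : RR * RR) := F (xz.1, xz.1 + xz.2)%R.
have mG : measurable_fun [set: RR * RR] G.
  apply: measurableT_comp => //; apply: measurable_fun_pair => //.
  exact: measurable_funD.
have G0 xz : 0 <= G xz by exact: F0.
transitivity (\int[joint]_xz G xz).
  by rewrite (ge0_integral_pushforward measurable_XZ)//; move=> xy _; exact: F0.
transitivity (\int[distribution P mfunX \x distribution P mfunZ]_xz G xz).
  by apply: eq_measure_integral => A mA _; rewrite -jointE.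
rewrite fubini_tonelli1//.
rewrite /fubini_F.
pose Fh (xy : RR * RR) := F xy * (h (xy.2 - xy.1))%:E.
have mFh : measurable_fun [set: RR * RR] Fh.
  apply: emeasurable_funM => //; apply/measurable_EFinP.
  by apply: (measurableT_comp mh); exact: measurable_funB.
have Fh0 xy : 0 <= Fh xy by rewrite mule_ge0// lee_fin.
have inner x : \int[distribution P mfunZ]_z G (x, z) = \int[mu]_y Fh (x, y).
  have mGx : measurable_fun [set: RR] (fun z => G (x, z)).
    exact: measurableT_comp.
  rewrite (@ge0_integral_density _ RR R mu (distribution P mfunZ) h mh h0 PZ _ mGx)//.
  have mGh : measurable_fun [set: RR] (fun z => G (x, z) * (h z)%:E).
    by apply: emeasurable_funM => //; exact/measurable_EFinP.
  rewrite -(ge0_integral_affine 1 (- x) (oner_neq0 R) _ mGh); last first.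
    by move=> y; rewrite mule_ge0 ?G0// lee_fin.
  rewrite normr1 mul1e; apply: eq_integral => y _.
  by rewrite mul1r /G /Fh /= subrKC.
under eq_integral do rewrite inner.
have mI : measurable_fun [set: RR] (fun x => \int[mu]_y Fh (x, y)).
  exact: (measurable_fun_fubini_tonelli_F Fh).
rewrite (@ge0_integral_density _ RR R mu (distribution P mfunX) f mf f0 PX _ mI); last first.
  by move=> x; exact: integral_ge0.
transitivity (\int[mu]_x \int[mu]_y (Fh (x, y) * (f x)%:E)).
  apply: eq_integral => x _; rewrite ge0_integralZr ?lee_fin//.
  exact: measurableT_comp.
rewrite (fubini_tonelli (fun xy => Fh xy * (f xy.1)%:E))//.
- apply: eq_integral => y _; apply: eq_integral => x _.
  by rewrite /Fh /= EFinM muleA.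
- apply: emeasurable_funM => //; apply/measurable_EFinP.
  exact: measurableT_comp.
- by move=> xy; rewrite mule_ge0// lee_fin.
Qed.

End independent_densities.

(** * Optimality of the linear estimator when the transform vanishes *)

Section linear_estimator.
Context {R : realType}.
Local Notation mu := (@lebesgue_measure R).
Variables (p a rho theta omega : R).
Hypotheses (p2 : 2 < p) (a0 : 0 < a) (rho1 : -1 <= rho <= 1).
Hypothesis zero : forall psi, gauss_cos (odd_powR p) psi omega = 0.

Let f := fX_unnorm a rho theta omega.

Lemma fX_unnorm_ge0 x : 0 <= fX_unnorm a rho theta omega x.
Proof.
rewrite mulr_ge0 ?expR_ge0//.
by have /andP[] := tilt_bounds _ rho1 (omega * x / Num.sqrt a + theta).
Qed.

Lemma measurable_fX_unnorm : measurable_fun setT (fX_unnorm a rho theta omega).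
Proof.
apply: measurable_funM.
  apply: (measurableT_comp (@measurable_expR R)); apply: measurable_funN.
  by apply: measurable_funM => //; apply: measurable_funM.
apply: measurable_funD => //; apply: measurable_funM => //.
apply: measurableT_comp.
  by apply: continuous_measurable_fun; exact: continuous_cos.
by apply: measurable_funD => //; apply: measurable_funM => //; exact: measurable_funM.
Qed.

(* Up to a factor independent of [x], the conditional density of [X] given
   [Y = y] at [x = sqrt a * u + a * y] is [exp (- u ^ 2 / 2)] times a tilt of
   frequency [omega]. *)
Let conditional_loss (c y m : R) : 0 <= c ->
  (\int[mu]_x (`|x - m| `^ p * (normal_pdf 0 1 (y - x) * (c * f x)))%:E =
   (Num.sqrt a)%:E *
   ((Num.sqrt a `^ p * c * normal_peak 1 * expR (- ((1 - a) * y ^+ 2 / 2)))%:E *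
    \int[mu]_u (`|u - (m - a * y) / Num.sqrt a| `^ p *
      (expR (- (1 / 2 * u ^+ 2)) *
       (1 + rho * cos (omega * u + (omega * Num.sqrt a * y + theta)))))%:E))%E.
Proof.
move=> c0.
have s0 : 0 < Num.sqrt a by rewrite sqrtr_gt0.
have sn0 : Num.sqrt a != 0 by rewrite gt_eqF.
have an0 : a != 0 by rewrite gt_eqF.
have sa : Num.sqrt a ^+ 2 = a by rewrite sqr_sqrtr// ltW.
have mpow m' : measurable_fun setT (fun x : R => `|x - m'| `^ p).
  apply: (measurableT_comp (measurable_powR p)).
  apply: measurableT_comp; first exact: normr_measurable.
  exact: measurable_funB.
rewrite -(ge0_integral_affine _ (a * y) sn0); first last.
- move=> x; rewrite lee_fin mulr_ge0 ?powR_ge0// mulr_ge0 ?normal_pdf_ge0//.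
  by rewrite mulr_ge0// fX_unnorm_ge0.
- apply/measurable_EFinP; apply: measurable_funM => //.
  apply: measurable_funM.
    apply: (measurableT_comp (measurable_normal_pdf 0 1)).
    exact: measurable_funB.
  by apply: measurable_funM => //; exact: measurable_fX_unnorm.
rewrite (gtr0_norm s0); congr (_ * _)%E.
rewrite -ge0_integralZl_EFin//; first last.
- rewrite !mulr_ge0 ?powR_ge0 ?expR_ge0 ?normal_peak_ge0//.
- apply/measurable_EFinP; apply: measurable_funM; first exact: mpow.
  apply: measurable_funM.
    apply: (measurableT_comp (@measurable_expR R)).
    by apply: measurable_funN; apply: measurable_funM.
  apply: measurable_funD => //; apply: measurable_funM => //.
  apply: measurableT_comp.
    by apply: continuous_measurable_fun; exact: continuous_cos.
  by apply: measurable_funD => //; exact: measurable_funM.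
- move=> u _; rewrite lee_fin mulr_ge0 ?powR_ge0// mulr_ge0 ?expR_ge0//.
  by have /andP[] := tilt_bounds _ rho1 (omega * u + (omega * Num.sqrt a * y + theta)).
apply: eq_integral => u _; rewrite -EFinM; congr EFin.
have -> : Num.sqrt a * u + a * y - m =
    Num.sqrt a * (u - (m - a * y) / Num.sqrt a) by field.
rewrite normrM (gtr0_norm s0) powRM ?(ltW s0)//.
rewrite normal_pdfE ?oner_neq0// /normal_fun /f /fX_unnorm.
have -> : omega * (Num.sqrt a * u + a * y) / Num.sqrt a + theta =
    omega * u + (omega * Num.sqrt a * y + theta).
  by rewrite -{2}sa; field.
(* Completing the square: the cross terms in [u] and [y] cancel. In [key], writing [a] as [s ^+ 2]
   reduces this to a rational identity. *)
have E : expR (- (y - (Num.sqrt a * u + a * y) - 0) ^+ 2 / (1 ^+ 2 *+ 2)) *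
    expR (- ((1 - a) / a * ((Num.sqrt a * u + a * y) ^+ 2 / 2))) =
    expR (- ((1 - a) * y ^+ 2 / 2)) * expR (- (1 / 2 * u ^+ 2)).
  have key (s : R) : s != 0 ->
      - (y - (s * u + s ^+ 2 * y) - 0) ^+ 2 / (1 ^+ 2 *+ 2) -
        (1 - s ^+ 2) / s ^+ 2 * ((s * u + s ^+ 2 * y) ^+ 2 / 2) =
      - ((1 - s ^+ 2) * y ^+ 2 / 2) - 1 / 2 * u ^+ 2.
    by move=> s0'; rewrite -mulr_natr; field.
  by rewrite -!expRD; congr expR; have := key _ sn0; rewrite sa.
move: E.
set e1 := expR _; set e2 := expR _; set e3 := expR _; set e4 := expR _ => E.
set t := 1 + _; set v := `|u - _| `^ p.
transitivity (Num.sqrt a `^ p * v * normal_peak 1 * c * t * (e1 * e2)); first by ring.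
by rewrite E; ring.
Qed.

(** For every [y], [conditional_loss] rewrites the inner integral as a common nonnegative factor
    times a loss shifted by [b = (g y - a * y) / Num.sqrt a]. The linear estimator has [b = 0], the
    minimum by [power_loss_min]. *)
Lemma linear_estimator_optimalP : linear_estimator_optimal p a rho theta omega.
Proof.
move=> d T P X Z mX mZ XZ PZ [c [c0 PX]] g mg.
have cf0 x : 0 <= c * f x by rewrite mulr_ge0 ?(ltW c0)// fX_unnorm_ge0.
have mcf : measurable_fun setT (fun x => c * f x).
  by apply: measurable_funM => //; exact: measurable_fX_unnorm.
have PX' A : measurable A ->
    P (X @^-1` A) = (\int[mu]_(x in A) (c * f x)%:E)%E.
  move=> mA; rewrite PX// -ge0_integralZl_EFin ?(ltW c0)//.
  - by move=> x _; rewrite lee_fin fX_unnorm_ge0.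
  - apply/measurable_EFinP; apply: measurable_funTS; exact: measurable_fX_unnorm.
have EE (h : R -> R) : measurable_fun setT h ->
    ('E_P[(fun w => `|X w - h (X w + Z w)| `^ p)%R] =
    \int[mu]_y \int[mu]_x
      (`|x - h y| `^ p * (normal_pdf 0 1 (y - x) * (c * f x)))%:E)%E.
  move=> mh; rewrite unlock.
  have := @ge0_integral_indep_sum _ _ _ P X Z _ _ mX mZ mcf cf0
    (measurable_normal_pdf 0 1) (normal_pdf_ge0 0 1) PX' PZ XZ
    (fun xy => (`|xy.1 - h xy.2| `^ p)%:E).
  move=> -> //.
  apply/measurable_EFinP; apply: (measurableT_comp (measurable_powR p)).
  apply: measurableT_comp; first exact: normr_measurable.
  by apply: measurable_funB => //; exact: measurableT_comp.
have mloss (h : R -> R) : measurable_fun setT h ->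
    measurable_fun setT (fun y : measurableTypeR R => (\int[mu]_x
      (`|x - h y| `^ p * (normal_pdf 0 1 (y - x) * (c * f x)))%:E)%E).
  move=> mh.
  apply: (@measurable_fun_fubini_tonelli_G _ _ (measurableTypeR R)
    (measurableTypeR R) R mu (fun xy =>
      (`|xy.1 - h xy.2| `^ p * (normal_pdf 0 1 (xy.2 - xy.1) * (c * f xy.1)))%:E)).
    apply/measurable_EFinP; apply: measurable_funM.
      apply: (measurableT_comp (measurable_powR p)).
      apply: measurableT_comp; first exact: normr_measurable.
      by apply: measurable_funB => //; exact: measurableT_comp.
    apply: measurable_funM; last exact: (measurableT_comp mcf).
    apply: (measurableT_comp (measurable_normal_pdf 0 1)).
    exact: measurable_funB.
  by move=> xy; rewrite lee_fin mulr_ge0 ?powR_ge0// mulr_ge0 ?normal_pdf_ge0.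
have mlin : measurable_fun setT (fun y : R => a * y) by exact: measurable_funM.
rewrite (EE _ mlin) (EE _ mg).
apply: ge0_le_integral; first exact: measurableT.
- move=> y _; apply: integral_ge0 => x _.
  by rewrite lee_fin mulr_ge0 ?powR_ge0// mulr_ge0 ?normal_pdf_ge0.
- exact: mloss.
- exact: mloss.
move=> y _; rewrite (conditional_loss c y (a * y) (ltW c0)).
rewrite (conditional_loss c y (g y) (ltW c0)) subrr mul0r.
apply: lee_wpmul2l; first by rewrite lee_fin sqrtr_ge0.
apply: lee_wpmul2l.
  by rewrite lee_fin !mulr_ge0 ?powR_ge0 ?expR_ge0 ?normal_peak_ge0// ltW.
under eq_integral do rewrite subr0.
exact: power_loss_min.
Qed.

End linear_estimator.

Theorem theorem13 (R : realType) (p a : R) :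
  2 < p -> 0 < a -> a < 1 ->
  (forall rho theta : R, -1 <= rho <= 1 ->
     exists omega : R, omega != 0 /\
       linear_estimator_optimal p a rho theta omega) /\
  (forall n : nat, p = (2 * n)%:R ->
     forall omega : R, hermite_He (2 * n).-1 omega = 0 ->
     forall rho theta : R, -1 <= rho <= 1 ->
       linear_estimator_optimal p a rho theta omega).
Proof.
move=> p2 a0 _.
have q0 : 0 <= p - 1 by rewrite subr_ge0 ltW// (lt_trans _ p2)// ltr1n.
have odd_zero omega : gauss_cos (odd_powR p) (- (pi / 2)) omega = 0 ->
    forall psi, gauss_cos (odd_powR p) psi omega = 0.
  apply: (gauss_cos_odd_eq0 _ (p - 1)) => //.
  - exact: measurable_odd_powR.
  - by move=> u; rewrite norm_odd_powR.
  - exact: odd_powRN.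
split=> [rho theta rho1|n pE omega].
  have [omega omega0 /odd_zero zero] := exists_zero_gauss_sin _ p2.
  exists omega; split; first by rewrite gt_eqF.
  exact: linear_estimator_optimalP.
(* The case [n = 0] would give [p = 0], against [2 < p]. *)
case: n pE => [|n] pE; first by move: p2; rewrite pE muln0 ltrn0.
move=> /gauss_sin_hermite_zero; rewrite -pE => /odd_zero zero rho theta rho1.
exact: linear_estimator_optimalP.
Qed.
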